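(* Let $l,n\ge 1$ be integers with $n\ge l$, let $\mathcal{V}=\mathcal{M}_{l,1}^n$ be the space of $n$-tuples of column vectors in $\mathbb{C}^l$ (equivalently, the space of $l\times n$ complex matrices), let $G=\operatorname{SL}_l(\mathbb{C})$ act on $\mathcal{V}$ by simultaneous left multiplication, and let $\mathcal{S}_{G,\mathcal{V}}\subseteq\mathcal{V}^2$ be the separating variety. (a) Suppose $l\ge 3$. The separating variety $\mathcal{S}_{G,\mathcal{V}}$ has two components, of dimensions $ln+l^2-1$ and $2(n+1)(l-1)$ respectively, which intersect in a closed subvariety of dimension $\le ln+l^2-2$ (with equality if $l=3$). (b) Suppose $l=2$. Then $\mathcal{S}_{G,\mathcal{V}}$ has just one irreducible component.
   Context: The group $G$ acts on polynomial functions $f\in\mathbb{C}[\mathcal{V}]$ by $(g\cdot f)(v)=f(g^{-1}\cdot v)$, and $\mathbb{C}[\mathcal{V}]^G$ is the algebra of invariant polynomial functions. The separating variety is the closed subvariety $$\mathcal{S}_{G,\mathcal{V}}=\{(v,w)\in\mathcal{V}^2: f(v)=f(w)\ \text{for all } f\in\mathbb{C}[\mathcal{V}]^G\}.$$ Components are irreducible components; closedness, irreducibility and dimension are with respect to the Zariski topology.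
   Formalization: In (a), that the two closed irreducible sets are exactly the two distinct components is claimed only for n > l; for n = l ≥ 3 it is false, since the separating variety is the irreducible hypersurface det v = det w. The union, dimensions and intersection are still proved for n = l. *)

(* Defs.v *)
From mathcomp Require Import all_boot all_order all_algebra.
From mathcomp Require Import complex mpoly.
From mathcomp Require Import boolp classical_sets reals.

Set Implicit Arguments.
Unset Strict Implicit.
Unset Printing Implicit Defensive.

Import GRing.Theory.
Local Open Scope ring_scope.
Local Open Scope classical_set_scope.

Section Zariski.
Variables (K : fieldType) (V : vectType K).
Implicit Types (f : V -> K) (A X Z : set V).

(* A polynomial in the linear coordinates with respect to a basis of V; the
   resulting set of functions does not depend on the basis. *)
Definition polynomial_fun f : Prop :=
  exists p : {mpoly K[\dim {:V}]},
    forall v, f v = p.@[fun i => coord (vbasis {:V}) i v].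

Definition zariski_closed A : Prop :=
  exists2 F : set (V -> K), F `<=` polynomial_fun &
    A = [set v | forall f, F f -> f v = 0].

(* Irreducibility of A in the subspace topology, phrased with closed subsets of
   the ambient space; the empty set is not irreducible. *)
Definition zariski_irreducible A : Prop :=
  A !=set0 /\
  forall B C : set V, zariski_closed B -> zariski_closed C ->
    A `<=` B `|` C -> A `<=` B \/ A `<=` C.

Definition irreducible_components X : set (set V) :=
  [set Z | [/\ zariski_irreducible Z, Z `<=` X &
    forall Z', zariski_irreducible Z' -> Z' `<=` X -> Z `<=` Z' -> Z' = Z]].

Definition zariski_closed_in X Z : Prop :=
  exists2 F, zariski_closed F & Z = X `&` F.

(* A chain Z 0 < Z 1 < ... < Z k of irreducible closed subsets of X has
   length k; the values of Z beyond k are irrelevant. *)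
Definition irreducible_chain X (k : nat) (Z : nat -> set V) : Prop :=
  (forall i, (i <= k)%N -> zariski_closed_in X (Z i) /\ zariski_irreducible (Z i))
  /\ (forall i, (i < k)%N -> Z i `<` Z i.+1).

(* Krull dimension, i.e. the supremum of the lengths of such chains. *)
Definition zariski_dim_le X (d : nat) : Prop :=
  forall k (Z : nat -> set V), irreducible_chain X k Z -> (k <= d)%N.

Definition zariski_dim X (d : nat) : Prop :=
  (exists Z : nat -> set V, irreducible_chain X d Z) /\ zariski_dim_le X d.

End Zariski.

Section SeparatingVariety.
Variables (K : fieldType) (l n : nat).

Definition SL : set 'M[K]_l := [set g | \det g = 1].

Definition fun_act (g : 'M[K]_l) (f : 'M[K]_(l, n) -> K) : 'M[K]_(l, n) -> K :=
  fun v => f (invmx g *m v).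

Definition SL_invariants : set ('M[K]_(l, n) -> K) :=
  [set f | polynomial_fun f /\ forall g, SL g -> fun_act g f = f].

Definition separating_variety : set ('M[K]_(l, n) * 'M[K]_(l, n)) :=
  [set vw | forall f, SL_invariants f -> f vw.1 = f vw.2].

End SeparatingVariety.

Arguments separating_variety : clear implicits.

(* Main.v *)
Require Import Defs.
From HB Require Import structures.
From mathcomp Require Import all_boot all_order all_algebra.
From mathcomp Require Import complex mpoly zify.
From mathcomp Require Import boolp classical_sets reals.

Set Implicit Arguments.
Unset Strict Implicit.
Unset Printing Implicit Defensive.

Import Order.TTheory GRing.Theory Num.Theory.
Local Open Scope ring_scope.
Local Open Scope classical_set_scope.

(** Let [C1] be the Zariski closure of the set of pairs [(u, g u)] with [g] of
    determinant 1, and [C2] the set of pairs of matrices of rank less than [l].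

    The separating variety is [C1 `|` C2]. The maximal minors are invariants; by
    Cramer's rule, a matrix [w] with the same maximal minors as a matrix [v] of
    rank [l] is [g v] with [g] in SL (same_minors_SL). When [v] has smaller rank,
    so has [w]; conversely a one-parameter subgroup of SL contracts a matrix of
    rank less than [l] to 0, so that all invariants take at such a matrix their
    value at 0 (invariant_rank_deficient).

    A set is irreducible as soon as any two of its points lie on a polynomial
    curve inside it (irreducible_closure): on the curve, polynomial functions
    are polynomials in one variable. For [C2] the curves come from the
    factorization of a matrix of rank at most [l - 1] through a space of
    dimension [l - 1]. For [C1] they have the form [(A u, B u)] with [A], [B], [u]
    moving and [\det A = \det B]; such a pair lies in [C1], even for singular [A]
    and [B], because Gaussian elimination deforms [A] and [B] into invertible
    matrices that keep a common determinant (closure_orbit_graph_mul).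
    This also gives [C2 `<=` C1] for [l = 2]. For [l >= 3] and [n > l], the
    inclusion fails, since on [C1] the rows of both matrices together span at
    most [l] dimensions.

    For the dimensions, a chain of length [k] of irreducible closed subsets of
    [X] yields [k] algebraically independent polynomial functions on [X]
    (chain_alg_indep): each step provides a function that vanishes on the
    smaller set and not on the larger. By counting monomials, there are at most
    [d] such functions on the image of a space of dimension [d]
    (mpoly_dependent). This bounds the dimension of [C2], which is covered by
    the charts in which one row is a combination of the others. In the case of
    [C1] the parameters are [u] and [g], and the equation [\det g = 1] takes
    away one; a maximal minor of the first matrix vanishes on [C1 `&` C2] and
    takes away another.

    Chains of the required length are closures of the images of a flag of
    subspaces under a parametrization: the inclusions are strict when each
    parameter can be recovered polynomially once the later parameters
    are set to 0 (chain_to_flag). The set [C2] is parametrized by the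
    coefficients of a linear relation and the rows other than the dependent one;
    [C1 `&` C2] by pairs [(A u, B u)] with [A] and [B] singular. Adding [C1]
    itself on top of the latter chain gives the dimension of [C1]. *)

(** * Polynomial functions and polynomial maps *)

Section PolynomialFunctions.
Variable K : numFieldType.
Implicit Types U V W : vectType K.

Lemma polyfun_cst V (c : K) : polynomial_fun (fun _ : V => c).
Proof. by exists c%:MP => v; rewrite mevalC. Qed.

Lemma polyfunD V (f g : V -> K) :
  polynomial_fun f -> polynomial_fun g -> polynomial_fun (fun v => f v + g v).
Proof. by move=> [p fE] [q gE]; exists (p + q) => v; rewrite mevalD fE gE. Qed.

Lemma polyfunM V (f g : V -> K) :
  polynomial_fun f -> polynomial_fun g -> polynomial_fun (fun v => f v * g v).
Proof. by move=> [p fE] [q gE]; exists (p * q) => v; rewrite mevalM fE gE. Qed.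

Lemma polyfunB V (f g : V -> K) :
  polynomial_fun f -> polynomial_fun g -> polynomial_fun (fun v => f v - g v).
Proof. by move=> [p fE] [q gE]; exists (p - q) => v; rewrite mevalB fE gE. Qed.

Lemma polyfun_sum V I (s : seq I) (f : I -> V -> K) :
  (forall i, polynomial_fun (f i)) ->
  polynomial_fun (fun v => \sum_(i <- s) f i v).
Proof.
move=> fP; elim: s => [|i s IHs].
  by under eq_fun do rewrite big_nil; exact: polyfun_cst.
by under eq_fun do rewrite big_cons; exact: polyfunD.
Qed.

Lemma polyfun_prod V I (s : seq I) (f : I -> V -> K) :
  (forall i, polynomial_fun (f i)) ->
  polynomial_fun (fun v => \prod_(i <- s) f i v).
Proof.
move=> fP; elim: s => [|i s IHs].
  by under eq_fun do rewrite big_nil; exact: polyfun_cst.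
by under eq_fun do rewrite big_cons; exact: polyfunM.
Qed.

Lemma polyfun_linear V (f : {linear V -> K^o}) : polynomial_fun (f : V -> K).
Proof.
pose b := vbasis {:V}.
have -> : (f : V -> K) = fun v => \sum_i coord b i v * f b`_i.
  apply: funext => v; rewrite {1}(coord_vbasis (memvf v)) linear_sum.
  by apply: eq_bigr => i _; rewrite linearZ.
apply: polyfun_sum => i; apply: polyfunM; last exact: polyfun_cst.
by exists 'X_i => v; rewrite mevalXU.
Qed.

(** Polynomial maps are encoded as the maps along which polynomial functions
    pull back to polynomial functions, so that composition is immediate and no
    basis is mentioned. *)
Definition polynomial_map V W (phi : V -> W) : Prop :=
  forall f : W -> K, polynomial_fun f -> polynomial_fun (f \o phi).

Lemma polymap_coord V W (phi : V -> W) :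
  (forall i, polynomial_fun (fun v => coord (vbasis {:W}) i (phi v))) ->
  polynomial_map phi.
Proof.
move=> /fin_all_exists [q qE] f [p fE].
exists (p \mPo [tuple q i | i < \dim {:W}]) => v.
rewrite /= fE comp_mpoly_meval; apply: meval_eq => i.
by rewrite tnth_mktuple qE.
Qed.

Lemma polymap_id V : polynomial_map (@id V).
Proof. by []. Qed.

Lemma polymap_comp U V W (psi : V -> W) (phi : U -> V) :
  polynomial_map psi -> polynomial_map phi ->
  polynomial_map (fun u => psi (phi u)).
Proof. by move=> psiP phiP f /psiP /phiP. Qed.

Lemma polymap_cst V W (w : W) : polynomial_map (fun _ : V => w).
Proof. by move=> f _; exact: polyfun_cst. Qed.

Lemma polymap_linear V W (phi : {linear V -> W}) : polynomial_map phi.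
Proof.
apply: polymap_coord => i.
pose c : {linear W -> K^o} := coord (vbasis {:W}) i.
exact: (@polyfun_linear _ (c \o phi)).
Qed.

Lemma polymapD V W (phi psi : V -> W) :
  polynomial_map phi -> polynomial_map psi ->
  polynomial_map (fun v => phi v + psi v).
Proof.
move=> phiP psiP; apply: polymap_coord => i.
under eq_fun do rewrite linearD.
by apply: polyfunD; [apply: phiP|apply: psiP];
  exists 'X_i => v; rewrite mevalXU.
Qed.

Lemma polymapZ V W (f : V -> K) (phi : V -> W) :
  polynomial_fun f -> polynomial_map phi ->
  polynomial_map (fun v => f v *: phi v).
Proof.
move=> fP phiP; apply: polymap_coord => i.
under eq_fun do rewrite linearZ.
by apply: polyfunM fP _; apply: phiP; exists 'X_i => v; rewrite mevalXU.
Qed.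

Lemma polymap_sum V W I (s : seq I) (phi : I -> V -> W) :
  (forall i, polynomial_map (phi i)) ->
  polynomial_map (fun v => \sum_(i <- s) phi i v).
Proof.
move=> phiP; elim: s => [|i s IHs].
  by under eq_fun do rewrite big_nil; exact: polymap_cst.
by under eq_fun do rewrite big_cons; exact: polymapD.
Qed.

Lemma polymap_fst V W : polynomial_map (fun x : V * W => x.1).
Proof. exact: (@polymap_linear (V * W)%type V fst). Qed.

Lemma polymap_snd V W : polynomial_map (fun x : V * W => x.2).
Proof. exact: (@polymap_linear (V * W)%type W snd). Qed.

Lemma inl_is_linear V W : linear (fun v : V => (v, 0) : V * W).
Proof. by move=> a x y; congr pair; rewrite /= ?scaler0 ?addr0. Qed.

Lemma inr_is_linear V W : linear (fun w : W => (0, w) : V * W).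
Proof. by move=> a x y; congr pair; rewrite /= ?scaler0 ?addr0. Qed.

Lemma polymap_of_linear V W (phi : V -> W) : linear phi -> polynomial_map phi.
Proof.
move=> phiL; pose m := GRing.isLinear.Build _ _ _ _ _ phiL.
pose F : {linear V -> W} := HB.pack phi m.
exact: (polymap_linear F).
Qed.

Lemma polymap_pair U V W (phi : U -> V) (psi : U -> W) :
  polynomial_map phi -> polynomial_map psi ->
  polynomial_map (fun u => (phi u, psi u)).
Proof.
move=> phiP psiP.
have -> : (fun u => (phi u, psi u)) = fun u => (phi u, 0) + (0, psi u).
  by apply: funext => u; congr pair; rewrite /= ?addr0 ?add0r.
apply: polymapD.
- exact: polymap_comp (polymap_of_linear (@inl_is_linear V W)) phiP.
- exact: polymap_comp (polymap_of_linear (@inr_is_linear V W)) psiP.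
Qed.

Lemma polyfun_map V (f : V -> K) :
  polynomial_map (f : V -> K^o) -> polynomial_fun f.
Proof. by move=> fP; apply: (fP id); exact: (@polyfun_linear K^o idfun). Qed.

Lemma entry_is_linear m n (i : 'I_m) (j : 'I_n) :
  linear (fun A : 'M[K]_(m, n) => A i j : K^o).
Proof. by move=> a A B; rewrite !mxE. Qed.

Lemma polyfun_entry V m n (F : V -> 'M[K]_(m, n)) i j :
  polynomial_map F -> polynomial_fun (fun v => F v i j).
Proof.
move=> FP; apply: polyfun_map.
exact: polymap_comp (polymap_of_linear (entry_is_linear i j)) FP.
Qed.

Lemma polymap_mx V m n (F : V -> 'M[K]_(m, n)) :
  (forall i j, polynomial_fun (fun v => F v i j)) -> polynomial_map F.
Proof.
move=> FP.
have -> : F = fun v => \sum_i \sum_j F v i j *: delta_mx i j.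
  by apply: funext => v; exact: matrix_sum_delta.
apply: polymap_sum => i; apply: polymap_sum => j.
by apply: polymapZ => //; exact: polymap_cst.
Qed.

Lemma polymap_mulmx V m n p (F : V -> 'M[K]_(m, n)) (G : V -> 'M[K]_(n, p)) :
  polynomial_map F -> polynomial_map G -> polynomial_map (fun v => F v *m G v).
Proof.
move=> FP GP; apply: polymap_mx => i j; under eq_fun do rewrite mxE.
by apply: polyfun_sum => k; apply: polyfunM; exact: polyfun_entry.
Qed.

Lemma polyfun_det V n (F : V -> 'M[K]_n) :
  polynomial_map F -> polynomial_fun (fun v => \det (F v)).
Proof.
move=> FP; apply: polyfun_sum => s; apply: polyfunM; first exact: polyfun_cst.
by apply: polyfun_prod => i; exact: polyfun_entry.
Qed.

Lemma polymap_row_mx V m n p (F : V -> 'M[K]_(m, n)) (G : V -> 'M[K]_(m, p)) :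
  polynomial_map F -> polynomial_map G ->
  polynomial_map (fun v => row_mx (F v) (G v)).
Proof.
move=> FP GP; apply: polymap_mx => i j; under eq_fun do rewrite mxE.
by case: split => k; exact: polyfun_entry.
Qed.

Lemma polymap_col_mx V m n p (F : V -> 'M[K]_(n, m)) (G : V -> 'M[K]_(p, m)) :
  polynomial_map F -> polynomial_map G ->
  polynomial_map (fun v => col_mx (F v) (G v)).
Proof.
move=> FP GP; apply: polymap_mx => i j; under eq_fun do rewrite mxE.
by case: split => k; exact: polyfun_entry.
Qed.

Lemma polymap_fst_comp U V W (phi : U -> V * W) :
  polynomial_map phi -> polynomial_map (fun u => (phi u).1).
Proof. exact: polymap_comp (@polymap_fst V W). Qed.

Lemma polymap_snd_comp U V W (phi : U -> V * W) :
  polynomial_map phi -> polynomial_map (fun u => (phi u).2).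
Proof. exact: polymap_comp (@polymap_snd V W). Qed.

Lemma polymap_linear_comp U V W (F : {linear V -> W}) (phi : U -> V) :
  polynomial_map phi -> polynomial_map (fun u => F (phi u)).
Proof. exact: polymap_comp (polymap_linear F). Qed.

(** Makes questions along a curve accessible to root counting. *)
Lemma polyfun_curve (f : K^o -> K) :
  polynomial_fun f -> exists p : {poly K}, forall t, f t = p.[t].
Proof.
move=> [p fE]; pose b := vbasis {:K^o}.
pose q := \sum_(m <- msupp p)
  p@_m *: \prod_i (coord b i (1 : K^o) *: 'X) ^+ m i.
exists q => t; rewrite fE mevalE /q horner_sum; apply: eq_bigr => m _.
rewrite hornerZ horner_prod; congr (_ * _); apply: eq_bigr => i _.
rewrite horner_exp hornerZ hornerX mulrC.
have {1}-> : t = t *: (1 : K^o) by rewrite /GRing.scale /= mulr1.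
by rewrite linearZ.
Qed.

Lemma curve_polyfun (p : {poly K}) : polynomial_fun (fun t : K^o => p.[t]).
Proof.
elim/poly_ind: p => [|p c IHp].
  by under eq_fun do rewrite horner0; exact: polyfun_cst.
under eq_fun do rewrite hornerMXaddC.
apply: polyfunD (polyfun_cst _ _); apply: polyfunM IHp _.
exact: (@polyfun_linear K^o idfun).
Qed.

Lemma poly_nonroot (p : {poly K}) : p != 0 -> exists t, p.[t] != 0.
Proof.
move=> p0; apply: contrapT => /forallNP pz.
pose s := [seq i%:R : K | i <- iota 0 (size p)].
suff : (size s < size p)%N by rewrite size_map size_iota ltnn.
apply: max_poly_roots => //.
  by apply/allP => x _; apply/negPn/negP => /pz.
by rewrite map_inj_uniq ?iota_uniq//; exact: mulrIn (oner_neq0 _).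
Qed.

(** Extends an identity from the generic points of a curve to the remaining
    ones. *)
Lemma poly_cofinite0 (p q : {poly K}) :
  q != 0 -> (forall t, q.[t] != 0 -> p.[t] = 0) -> p = 0.
Proof.
move=> q0 pz; apply: contrapT => /eqP p0.
have [t] := poly_nonroot (mulf_neq0 p0 q0).
by rewrite hornerM mulf_eq0 negb_or => /andP[/negP] pt /pz /eqP.
Qed.

End PolynomialFunctions.

(** Proves that a map built from projections, constants, sums, products and
    blocks of matrices is polynomial. Linear maps come last because any
    application could be tried as one. *)
Ltac polymap := repeat first
  [ exact: polymap_id | exact: polymap_cst | apply: polymap_pair
  | apply: polymap_mulmx | apply: polymap_row_mx | apply: polymap_col_mx
  | apply: polymap_fst_comp | apply: polymap_snd_comp | apply: polymapD
  | apply: polymap_linear_comp ].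

Lemma dim_prod (K : fieldType) (V1 V2 : vectType K) :
  \dim {:(V1 * V2)%type} = (\dim {:V1} + \dim {:V2})%N.
Proof. by rewrite !dimvf. Qed.

Lemma dim_mx (K : fieldType) a b : \dim {:'M[K]_(a, b)} = (a * b)%N.
Proof. by rewrite dimvf dim_matrix. Qed.

(** * Algebraic independence *)

Section MultivariateAsUnivariate.
Variables (K : fieldType) (n : nat).
Implicit Types P : {mpoly K[n.+1]}.

Local Notation shrink m := [multinom (m (lift ord_max i)) | i < n].

Let widen_lift (i : 'I_n) : widen_ord (leqnSn n) i = lift ord_max i.
Proof. by apply: val_inj; rewrite /= /bump leqNgt ltn_ord. Qed.

Let muni_lift P : muni P =
  \sum_(m <- msupp P) P@_m *: 'X_[shrink m] *: 'X^(m ord_max).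
Proof.
rewrite muniE; apply: eq_bigr => m _; congr (_ *: 'X_[_] *: _).
by apply/mnmP => i; rewrite !mnmE widen_lift.
Qed.

Lemma muni_meval P (v : 'I_n.+1 -> K) :
  P.@[v] = (map_poly (meval (fun i => v (lift ord_max i))) (muni P)).[v ord_max].
Proof.
rewrite muni_lift mevalE raddf_sum /= horner_sum; apply: eq_bigr => m _.
rewrite map_polyZ /= map_polyXn hornerZ hornerXn mevalZ mevalX -mulrA.
congr (_ * _); rewrite big_ord_recr /=; congr (_ * _).
by apply: eq_bigr => i _; rewrite mnmE widen_lift.
Qed.

Lemma muni_inj0 P : muni P = 0 -> P = 0.
Proof.
move=> P0; apply/mpolyP => m; rewrite mcoeff0.
have [mP|/memN_msupp_eq0//] := boolP (m \in msupp P).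
have := congr1 (fun q : {poly {mpoly K[n]}} => q`_(m ord_max)@_(shrink m)) P0.
rewrite coef0 mcoeff0 muni_lift coef_sum raddf_sum /=.
rewrite (bigD1_seq m) ?msupp_uniq//= big1 ?addr0.
  by rewrite coefZ coefXn eqxx mulr1 mcoeffZ mcoeffX eqxx mulr1.
move=> m' m'm; rewrite coefZ coefXn.
have [eqmax|] := eqVneq (m ord_max) (m' ord_max); last by rewrite mulr0 mcoeff0.
rewrite mulr1 mcoeffZ mcoeffX; case: eqP => [eqm|]; last by rewrite mulr0.
case/eqP: m'm; apply/mnmP => i.
have [j ->|->//] := unliftP ord_max i.
by have := congr1 (fun m : 'X_{1..n} => m j) eqm; rewrite !mnmE.
Qed.

End MultivariateAsUnivariate.

Section AlgebraicIndependence.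
Variable K : numFieldType.
Implicit Types V W : vectType K.

Definition alg_indep (T : Type) (X : set T) k (f : 'I_k -> T -> K) : Prop :=
  forall P : {mpoly K[k]},
    (forall x, X x -> P.@[fun i => f i x] = 0) -> P = 0.

Definition integral_set V (X : set V) : Prop :=
  forall f g : V -> K, polynomial_fun f -> polynomial_fun g ->
    (forall x, X x -> f x * g x = 0) ->
    (forall x, X x -> f x = 0) \/ (forall x, X x -> g x = 0).

Definition fun_rcons T k (f : 'I_k -> T -> K) (h : T -> K) (i : 'I_k.+1) :=
  if unlift ord_max i is Some j then f j else h.

Lemma polyfun_rcons V k (f : 'I_k -> V -> K) h :
  (forall i, polynomial_fun (f i)) -> polynomial_fun h ->
  forall i, polynomial_fun (fun_rcons f h i).
Proof. by move=> fP hP i; rewrite /fun_rcons; case: unlift. Qed.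

Lemma polyfun_horner V k (f : 'I_k -> V -> K) h (p : {poly {mpoly K[k]}}) :
  (forall i, polynomial_fun (f i)) -> polynomial_fun h ->
  polynomial_fun (fun x => (map_poly (meval (fun i => f i x)) p).[h x]).
Proof.
move=> fP hP; elim/poly_ind: p => [|p c IHp].
  by under eq_fun do rewrite rmorph0 horner0; exact: polyfun_cst.
under eq_fun do rewrite rmorphD rmorphM /= map_polyX map_polyC hornerMXaddC.
apply: polyfunD; first exact: polyfunM.
under eq_fun do rewrite /= mevalE.
apply: polyfun_sum => m; apply: polyfunM; first exact: polyfun_cst.
apply: polyfun_prod => i; elim: (m i) => [|e IHe].
  by under eq_fun do rewrite expr0; exact: polyfun_cst.
by under eq_fun do rewrite exprS; exact: polyfunM.
Qed.

(** Read a relation between the [f i] and [h] on [Y] as a polynomial in [h].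
    Its constant coefficient is a relation between the [f i] on [X], hence is
    zero; so the relation is divisible by [h], which can be cancelled on [Y],
    and the degree drops. *)
Lemma alg_indep_rcons V (X Y : set V) k (f : 'I_k -> V -> K) h :
  (forall i, polynomial_fun (f i)) -> polynomial_fun h ->
  X `<=` Y -> alg_indep X f -> (forall x, X x -> h x = 0) ->
  integral_set Y -> ~ (forall y, Y y -> h y = 0) ->
  alg_indep Y (fun_rcons f h).
Proof.
move=> fP hP XY findep hX Yint hY.
suff key (p : {poly {mpoly K[k]}}) :
    (forall y, Y y -> (map_poly (meval (fun i => f i y)) p).[h y] = 0) -> p = 0.
  move=> P PY; apply: muni_inj0; apply: key => y Yy.
  have := PY y Yy; rewrite muni_meval /fun_rcons unlift_none => <-.
  congr (map_poly _ _).[_]; apply: funext => q; apply: meval_eq => i.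
  by rewrite liftK.
have [d] := ubnP (size p); elim: d p => // d IHd p sp pY.
move: sp pY; elim/poly_ind: p => [//|p c _] sp pY.
have c0 : c = 0.
  apply: findep => x Xx; have := pY x (XY x Xx).
  rewrite rmorphD rmorphM /= map_polyX map_polyC hornerMXaddC hX//.
  by rewrite mulr0 add0r.
rewrite c0 addr0 in sp pY *.
have [->|p0] := eqVneq p 0; first by rewrite mul0r.
rewrite (IHd p) ?mul0r//; first by rewrite size_mulX in sp.
case: (Yint _ _ (polyfun_horner p fP hP) hP) => // y /pY.
by rewrite rmorphM /= map_polyX hornerMX.
Qed.

Lemma alg_indepW (T : Type) (X Y : set T) k (f : 'I_k -> T -> K) :
  X `<=` Y -> alg_indep X f -> alg_indep Y f.
Proof. by move=> XY fX P PY; apply: fX => x /XY /PY. Qed.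

End AlgebraicIndependence.

Section Counting.
Variables (K : fieldType) (k d : nat).

Let msize_prod (e D : nat) (q : 'I_k -> {mpoly K[d]}) (a : 'I_k -> nat) :
  (forall i, (msize (q i) <= e.+1)%N) -> (forall i, (a i <= D)%N) ->
  (msize (\prod_i q i ^+ a i) <= (k * (D * e)).+1)%N.
Proof.
have msizeMle (p1 p2 : {mpoly K[d]}) m1 m2 : (msize p1 <= m1.+1)%N ->
    (msize p2 <= m2.+1)%N -> (msize (p1 * p2) <= (m1 + m2).+1)%N.
  have [->|p10] := eqVneq p1 0; first by rewrite mul0r msize0.
  have [->|p20] := eqVneq p2 0; first by rewrite mulr0 msize0.
  by rewrite msizeM//; move: (msize p1) (msize p2) => s1 s2; lia.
move=> qe aD; have qae i : (msize (q i ^+ a i) <= (D * e).+1)%N.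
  apply: (@leq_trans (a i * e).+1); last by rewrite ltnS leq_mul2r aD orbT.
  elim: (a i) => [|b IHb]; first by rewrite expr0 msize1.
  by rewrite exprS mulSn; exact: msizeMle.
have -> : (k * (D * e) = \sum_(i < k) D * e)%N by rewrite sum_nat_const card_ord.
elim/big_rec2: _ => [|i m p _ IHp]; first by rewrite msize1.
exact: msizeMle.
Qed.

(** The monomials in the [q i] with exponents at most [D] number [D.+1 ^ k],
    while their degrees grow linearly in [D], so that they lie in a space of
    dimension [O(D ^ d)]. *)
Lemma mpoly_dependent (q : 'I_k -> {mpoly K[d]}) : (d < k)%N ->
  exists2 P : {mpoly K[k]}, P != 0 & P \mPo [tuple q i | i < k] = 0.
Proof.
move=> dk; pose e := (\max_i msize (q i))%N.
have qe i : (msize (q i) <= e.+1)%N by apply: leqW; exact: leq_bigmax.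
pose D := ((k * e).+1 ^ d)%N; pose N := (k * (D * e)).+1%N.
pose A := {ffun 'I_k -> 'I_D.+1}; pose B := {ffun 'I_d -> 'I_N}.
have cardBA : (#|{: B}| < #|{: A}|)%N.
  rewrite !card_ffun !card_ord.
  have NE : (N <= (k * e).+1 * D.+1)%N.
    by rewrite /N; nia.
  apply: (@leq_ltn_trans (((k * e).+1 * D.+1) ^ d)%N); first by have [->//|d0] := posnP d; rewrite leq_exp2r.
  rewrite expnMn -/D; apply: (@leq_trans (D.+1 ^ d.+1)%N); last by rewrite leq_pexp2l.
  by rewrite expnS ltn_pmul2r ?expn_gt0.
pose Q (a : A) := \prod_i q i ^+ a i.
pose mono n M (b : {ffun 'I_n -> 'I_M}) := [multinom (b i : nat) | i < n].
pose M := \matrix_(a < #|{: A}|, b < #|{: B}|)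
  (Q (enum_val a))@_(mono _ _ (enum_val b)).
have /rowV0Pn [c /sub_kermxP cM c0] : kermx M != 0.
  by rewrite kermx_eq0 -row_leq_rank -ltnNge (leq_ltn_trans (rank_leq_col M)).
exists (\sum_a c 0 a *: 'X_[mono _ _ (enum_val a)]).
  have /rV0Pn [a ca] := c0; apply: contra_neq ca => P0.
  have := congr1 (fun p : {mpoly K[k]} => p@_(mono _ _ (enum_val a))) P0.
  rewrite mcoeff0 raddf_sum /= (bigD1 a)//= big1 ?addr0.
    by rewrite mcoeffZ mcoeffX eqxx mulr1.
  move=> a' a'a; rewrite mcoeffZ mcoeffX; case: eqP => [eqm|]; last by rewrite mulr0.
  case/eqP: a'a; apply: enum_val_inj; apply/ffunP => i; apply: val_inj.
  by have := congr1 (fun m : 'X_{1..k} => m i) eqm; rewrite !mnmE.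
rewrite raddf_sum /=.
transitivity (\sum_a c 0 a *: Q (enum_val a)).
  apply: eq_bigr => a _; rewrite comp_mpolyZ comp_mpolyX; congr (_ *: _).
  by apply: eq_bigr => i _; rewrite tnth_mktuple mnmE.
apply/mpolyP => m; rewrite mcoeff0 raddf_sum /=.
have [mN|Nm] := ltnP (mdeg m) N; last first.
  apply: big1 => a _; rewrite mcoeffZ memN_msupp_eq0 ?mulr0//.
  apply/negP => /msize_mdeg_lt; apply/negP; rewrite -leqNgt.
  apply: leq_trans Nm; rewrite /N.
  by apply: msize_prod => // i; rewrite -ltnS.
have mi i : (m i < N)%N.
  by apply: leq_ltn_trans mN; rewrite mdegE (bigD1 i)//= leq_addr.
pose b : B := [ffun i => Ordinal (mi i)].
have := congr1 (fun x : 'rV_#|{: B}| => x 0 (enum_rank b)) cM.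
rewrite !mxE => cMb; rewrite -[RHS]cMb; apply: eq_bigr => a _; rewrite mxE enum_rankK mcoeffZ.
by congr (_ * _@_(_)); apply/mnmP => i; rewrite mnmE ffunE.
Qed.

End Counting.

Lemma alg_indep_leq_dim (K : numFieldType) (W : vectType K) k
    (f : 'I_k -> W -> K) :
  (forall i, polynomial_fun (f i)) -> alg_indep setT f -> (k <= \dim {:W})%N.
Proof.
move=> /fin_all_exists [q qE] findep; rewrite leqNgt; apply/negP.
move=> /(mpoly_dependent q) [P /eqP P0 Pq]; apply: P0; apply: findep => w _.
have := congr1 (meval (fun i => coord (vbasis {:W}) i w)) Pq.
rewrite meval0 comp_mpoly_meval => <-; apply: meval_eq => i.
by rewrite tnth_mktuple qE.
Qed.

(** * Zariski closure and irreducibility *)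

Section ZariskiTopology.
Variable K : numFieldType.
Implicit Types U V W : vectType K.

Lemma zariski_closed_zeros V (f : V -> K) :
  polynomial_fun f -> zariski_closed [set v | f v = 0].
Proof.
move=> fP; exists [set f]; first by move=> _ ->.
by apply/seteqP; split=> v /= fv; [move=> _ ->|exact: fv].
Qed.

Lemma zariski_closed_separate V (A : set V) v :
  zariski_closed A -> ~ A v ->
  exists f : V -> K, [/\ polynomial_fun f, forall a, A a -> f a = 0 & f v != 0].
Proof.
move=> [F FP AE] nAv; apply: contrapT => nf; apply: nAv; rewrite AE => f Ff.
apply/eqP/negPn/negP => fv; apply: nf; exists f; split=> //; first exact: FP.
by move=> a; rewrite AE; exact.
Qed.

Lemma zariski_closed_forall V I (A : I -> set V) :
  (forall i, zariski_closed (A i)) -> zariski_closed [set v | forall i, A i v].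
Proof.
move=> cA.
exists [set f | polynomial_fun f /\ exists i, forall a, A i a -> f a = 0].
  by move=> f [].
apply/seteqP; split=> v /= Av; first by move=> f [_ [i fA]]; exact: fA.
move=> i; apply: contrapT => /(zariski_closed_separate (cA i)) [f [fP fA]].
by rewrite (Av f) ?eqxx//; split=> //; exists i.
Qed.

Lemma zariski_closedI V (A B : set V) :
  zariski_closed A -> zariski_closed B -> zariski_closed (A `&` B).
Proof.
move=> cA cB.
have -> : A `&` B = [set v | forall b : bool, (if b then A else B) v].
  apply/seteqP; split=> v /=; first by case=> Av Bv; case.
  by move=> AB; split; [exact: (AB true)|exact: (AB false)].
by apply: zariski_closed_forall; case.
Qed.

Definition zariski_closure V (X : set V) : set V :=
  [set v | forall f : V -> K, polynomial_fun f ->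
    (forall x, X x -> f x = 0) -> f v = 0].

Lemma zariski_closure_closed V (X : set V) : zariski_closed (zariski_closure X).
Proof.
exists [set f | polynomial_fun f /\ forall x, X x -> f x = 0].
  by move=> f [].
by apply/seteqP; split=> v /= Xv f; [case=> fP; exact: Xv|move=> fP fX; exact: Xv].
Qed.

Lemma sub_zariski_closure V (X : set V) : X `<=` zariski_closure X.
Proof. by move=> v Xv f _; exact. Qed.

Lemma zariski_closure_min V (X A : set V) :
  zariski_closed A -> X `<=` A -> zariski_closure X `<=` A.
Proof.
move=> cA XA v Xv; apply: contrapT => /(zariski_closed_separate cA) [f [fP fA]].
by rewrite (Xv f fP) ?eqxx// => x /XA /fA.
Qed.

Lemma zariski_closure_id V (X : set V) : zariski_closed X -> zariski_closure X = X.
Proof.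
move=> cX; apply/seteqP; split; last exact: sub_zariski_closure.
exact: zariski_closure_min.
Qed.

Lemma zariski_closureS V (X Y : set V) :
  X `<=` Y -> zariski_closure X `<=` zariski_closure Y.
Proof.
move=> XY; apply: zariski_closure_min (zariski_closure_closed Y) _.
exact: subset_trans XY (@sub_zariski_closure _ Y).
Qed.

(** Along a polynomial curve a product of two nonzero polynomial functions is a
    nonzero polynomial in one variable: if two proper closed subsets covered
    the closure, the curve joining a point outside the first to a point outside
    the second would leave both. *)
Lemma irreducible_closure V (X : set V) :
  X !=set0 ->
  (forall x y, X x -> X y -> exists2 gamma : K^o -> V, polynomial_map gamma &
    [/\ gamma 0 = x, gamma 1 = y & forall t, zariski_closure X (gamma t)]) ->
  zariski_irreducible (zariski_closure X).
Proof.
move=> [x0 Xx0] Xjoin; split; first by exists x0; exact: sub_zariski_closure.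
move=> B C cB cC XBC.
have [XB|/existsNP[x /not_implyP[Xx nBx]]] := pselect (X `<=` B).
  by left; exact: zariski_closure_min.
have [XC|/existsNP[y /not_implyP[Xy nCy]]] := pselect (X `<=` C).
  by right; exact: zariski_closure_min.
have [f [fP fB fx]] := zariski_closed_separate cB nBx.
have [g [gP gC gy]] := zariski_closed_separate cC nCy.
have [gamma gammaP [g0 g1 gX]] := Xjoin x y Xx Xy.
have [p pE] := polyfun_curve (gammaP f fP).
have [q qE] := polyfun_curve (gammaP g gP).
have p0 : p != 0.
  by apply: contraNneq fx => p0; rewrite -g0 -[f _]/((f \o gamma) 0) pE p0 horner0.
have q0 : q != 0.
  by apply: contraNneq gy => q0; rewrite -g1 -[g _]/((g \o gamma) 1) qE q0 horner0.
have [t] := poly_nonroot (mulf_neq0 p0 q0).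
rewrite hornerM mulf_eq0 negb_or -pE -qE => /andP[/= ft gt].
have [/fB/eqP|/gC/eqP] := XBC _ (gX t); first by rewrite (negPf ft).
by rewrite (negPf gt).
Qed.

Lemma polymap_segment V (x y : V) :
  polynomial_map (fun t : K^o => x + t *: (y - x)).
Proof.
apply: polymapD; first exact: polymap_cst.
by apply: polymapZ (polymap_cst _ _); exact: (@polyfun_linear _ K^o idfun).
Qed.

Lemma irreducible_closure_image V W (phi : W -> V) (L : set W) :
  polynomial_map phi -> L !=set0 ->
  (forall x y t, L x -> L y -> L (x + t *: (y - x))) ->
  zariski_irreducible (zariski_closure (phi @` L)).
Proof.
move=> phiP [w0 Lw0] Lseg; apply: irreducible_closure; first by exists (phi w0), w0.
move=> _ _ [x Lx <-] [y Ly <-].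
exists (fun t => phi (x + t *: (y - x))).
  exact: polymap_comp phiP (polymap_segment x y).
split; rewrite ?scale0r ?addr0// ?scale1r ?subrKC// => t.
by apply: sub_zariski_closure; exists (x + t *: (y - x)) => //; exact: Lseg.
Qed.

Lemma irreducible_integral V (X : set V) :
  zariski_irreducible X -> integral_set X.
Proof.
move=> [_ Xirr] f g fP gP fg.
apply: (Xirr [set v | f v = 0] [set v | g v = 0]);
  [exact: zariski_closed_zeros|exact: zariski_closed_zeros|].
by move=> x /fg /eqP; rewrite mulf_eq0 => /orP[]/eqP; [left|right].
Qed.

Lemma integral_setT V : integral_set [set: V].
Proof.
apply: irreducible_integral.
have -> : [set: V] = zariski_closure (@id V @` setT).
  by apply/seteqP; split=> // v _; apply: sub_zariski_closure; exists v.
by apply: irreducible_closure_image; [exact: polymap_id|exists 0|].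
Qed.

End ZariskiTopology.

(** * Chains of irreducible closed sets *)

Section Dimension.
Variable K : numFieldType.
Implicit Types U V W : vectType K.

Lemma polyfun_meval V k (f : 'I_k -> V -> K) (P : {mpoly K[k]}) :
  (forall i, polynomial_fun (f i)) ->
  polynomial_fun (fun x => P.@[fun i => f i x]).
Proof.
move=> fP; have := polyfun_horner P%:P fP (polyfun_cst V 0).
by under eq_fun do rewrite map_polyC hornerC.
Qed.

Lemma alg_indep_closure V (X : set V) k (f : 'I_k -> V -> K) :
  (forall i, polynomial_fun (f i)) ->
  alg_indep (zariski_closure X) f -> alg_indep X f.
Proof.
move=> fP fX P PX; apply: fX => x xX.
exact: xX (polyfun_meval P fP) PX.
Qed.

Lemma alg_indep_image (T S : Type) (phi : S -> T) (X : set S) k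
    (f : 'I_k -> T -> K) :
  alg_indep (phi @` X) f -> alg_indep X (fun i => f i \o phi).
Proof. by move=> fX P PX; apply: fX => _ [x Xx <-]; exact: PX. Qed.

Lemma alg_indep0 (T : Type) (X : set T) (f : 'I_0 -> T -> K) :
  X !=set0 -> alg_indep X f.
Proof.
move=> [x Xx] P /(_ x Xx).
have -> : P = (P@_0)%:MP.
  apply/mpolyP => m; have -> : m = 0%MM by apply/mnmP; case.
  by rewrite mcoeffC eqxx mulr1.
by rewrite mevalC => ->; rewrite mpolyC0.
Qed.

(** Each strict inclusion of the chain provides one more function: one that
    vanishes on the smaller set but not on the larger. *)
Lemma chain_alg_indep V (X : set V) k (Z : nat -> set V) :
  irreducible_chain X k Z ->
  exists2 f : 'I_k -> V -> K,
    forall i, polynomial_fun (f i) & alg_indep (Z k) f.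
Proof.
elim: k => [|k IHk] [Zirr Zlt].
  exists (fun _ _ => 0); first by case.
  by apply: alg_indep0; case: (Zirr 0 isT) => _ [].
have [|f fP findep] := IHk.
  by split=> i ik; [exact/Zirr/leqW|exact/Zlt/leqW].
have [ZkS /existsNP[x /not_implyP[Zx nZx]]] := Zlt k (leqnn _).
have [[Fk cFk Zk] _] := Zirr k (leqnSn _).
have [[F _ ZE] /irreducible_integral Zint] := Zirr k.+1 (leqnn _).
have [|h [hP hF hx]] := @zariski_closed_separate K V Fk x cFk.
  by move=> Fx; apply: nZx; rewrite Zk; split=> //; move: Zx; rewrite ZE => -[].
exists (fun_rcons f h); first exact: polyfun_rcons.
apply: alg_indep_rcons ZkS findep _ Zint _ => //.
  by move=> z; rewrite Zk => -[_ /hF].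
by move=> /(_ x Zx)/eqP; rewrite (negPf hx).
Qed.

(** Bounds the Krull dimension by the transcendence degree. *)
Lemma zariski_dim_leP V (X : set V) d :
  (forall k (f : 'I_k -> V -> K), (forall i, polynomial_fun (f i)) ->
    alg_indep X f -> (k <= d)%N) ->
  zariski_dim_le X d.
Proof.
move=> Xd k Z Zchain; have [f fP findep] := chain_alg_indep Zchain.
apply: Xd fP (alg_indepW _ findep).
by have [Zirr _] := Zchain; have [[F _ ->] _] := Zirr k (leqnn k); exact: subIsetl.
Qed.

(** The product of the relations that hold on the charts holds on [X]. *)
Lemma alg_indep_charts V W (I : finType) (X : set V) (phi : I -> W -> V) k
    (f : 'I_k -> V -> K) :
  (forall i, polynomial_map (phi i)) ->
  (forall x, X x -> exists i w, x = phi i w) ->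
  (forall i, polynomial_fun (f i)) -> alg_indep X f -> (k <= \dim {:W})%N.
Proof.
move=> phiP Xphi fP findep; rewrite leqNgt; apply/negP => Wk.
have relation i : exists P : {mpoly K[k]}, P != 0 /\
    forall w, P.@[fun j => f j (phi i w)] = 0.
  apply: contrapT => nP; move: Wk; rewrite ltnNge => /negP; apply.
  apply: (@alg_indep_leq_dim K W k (fun j => f j \o phi i)).
    by move=> j; exact: phiP.
  move=> P P0; apply: contrapT => /eqP Pn; apply: nP; exists P; split=> // w.
  exact: P0.
have [P PP] := fin_all_exists relation.
have /eqP : \prod_i P i != 0 by apply/prodf_neq0 => i _; case: (PP i).
apply; apply: findep => x /Xphi [i [w ->]].
by rewrite rmorph_prod /= (bigD1 i)//= (PP i).2 mul0r.
Qed.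

(** The chain is kept together with its last member, the one that a longer chain
    continues. *)
Definition chain_to V (X : set V) k (Z : set V) : Prop :=
  exists2 Zs, irreducible_chain X k Zs & Zs k = Z.

Lemma chain_to0 V (X Z : set V) :
  zariski_closed Z -> zariski_irreducible Z -> Z `<=` X -> chain_to X 0 Z.
Proof.
move=> cZ iZ ZX; exists (fun _ => Z) => //; split=> // i _; split=> //.
by exists Z => //; rewrite setIC; apply/esym/setIidPl.
Qed.

Lemma chain_toS V (X Z Z' : set V) k :
  chain_to X k Z -> zariski_closed Z' -> zariski_irreducible Z' -> Z' `<=` X ->
  Z `<` Z' -> chain_to X k.+1 Z'.
Proof.
move=> [Zs [Zirr Zlt] ZsE] cZ' iZ' Z'X ZZ'.
exists (fun i => if (i <= k)%N then Zs i else Z'); last by rewrite ltnn.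
split=> i.
  rewrite leq_eqVlt ltnS => /predU1P[->|ik]; last by rewrite ik; exact: Zirr.
  rewrite ltnn; split=> //.
  by exists Z' => //; rewrite setIC; apply/esym/setIidPl.
rewrite ltnS => ik; rewrite ik; case: ltnP => [|ki]; first exact: Zlt.
by have -> : i = k by [apply/eqP; rewrite eqn_leq ik]; rewrite ZsE.
Qed.

Lemma chain_to_sub V (X X' Z : set V) k :
  zariski_closed X' -> X `<=` X' -> zariski_closed X ->
  chain_to X k Z -> chain_to X' k Z.
Proof.
move=> cX' XX' cX [Zs [Zirr Zlt] ZsE]; exists Zs => //; split=> // i ik.
have [[F cF ->] ?] := Zirr i ik; split=> //.
exists (X `&` F); first exact: zariski_closedI.
by rewrite setIA; congr (_ `&` _); apply/esym/setIidPr.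
Qed.

(** Freeing the coordinates of [w] one by one enlarges the closure of the image
    each time, since [psi] reads the coordinate that has just been freed. *)
Lemma chain_to_flag U V W (X : set V) k (phi : W * U -> V) (psi : V -> W) :
  polynomial_map phi -> polynomial_map psi ->
  (forall x, psi (phi x) = x.1) -> zariski_closed X -> (forall x, X (phi x)) ->
  chain_to X k (zariski_closure [set phi (0, u) | u in setT]) ->
  chain_to X (k + \dim {:W}) (zariski_closure (range phi)).
Proof.
move=> phiP psiP phiK cX phiX ch0; pose b := vbasis {:W}.
pose L j := [set x : W * U |
  forall i : 'I_(\dim {:W}), (j <= i)%N -> coord b i x.1 = 0].
have LX j : zariski_closure (phi @` L j) `<=` X.
  by apply: zariski_closure_min => // _ [x _ <-].
have LT : range phi = phi @` L (\dim {:W}).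
  congr (_ @` _); apply/seteqP; split=> // x _ i.
  by rewrite leqNgt ltn_ord.
suff key j : (j <= \dim {:W})%N -> chain_to X (k + j) (zariski_closure (phi @` L j)).
  by rewrite LT; exact: key.
elim: j => [_|j IHj jW].
  rewrite addn0; suff <- : [set phi (0, u) | u in setT] = phi @` L 0 by [].
  apply/seteqP; split=> y [].
    by move=> u _ <-; exists (0, u) => // i _; rewrite linear0.
  move=> [w u] Lwu <-; exists u => //; congr (phi (_, _)).
  by rewrite (coord_vbasis (memvf w)) big1// => i _; rewrite Lwu ?scale0r.
rewrite addnS; apply: chain_toS (IHj (ltnW jW)) _ _ _ _ => //.
- exact: zariski_closure_closed.
- apply: irreducible_closure_image => //; first by exists 0 => i _; rewrite linear0.
  move=> x y t Lx Ly i ji /=.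
  by rewrite linearD linearZ linearB /= Lx ?Ly// subrr mulr0 addr0.
split.
  by apply: zariski_closureS => _ [x Lx <-]; exists x => // i /ltnW; exact: Lx.
pose o := Ordinal jW; pose x : W * U := (b`_o, 0).
have Lx : L j.+1 x.
  move=> i ji; rewrite coord_free ?(basis_free (vbasisP _))//.
  by case: eqP ji => // <-; rewrite ltnn.
have xY : zariski_closure (phi @` L j.+1) (phi x).
  by apply: sub_zariski_closure; exists x.
move=> /(_ _ xY) /(_ (fun v => coord b o (psi v))) xz.
have /eqP := oner_neq0 K; apply.
have <- : coord b o (psi (phi x)) = 1.
  by rewrite phiK coord_free ?(basis_free (vbasisP _))// eqxx.
apply: xz => [|_ [y Ly <-]]; last by rewrite phiK; exact: Ly.
by apply: psiP; exists 'X_o => v; rewrite mevalXU.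
Qed.

Lemma chain_to_section (V W : vectType K) (X : set V) (phi : W -> V) (psi : V -> W) :
  polynomial_map phi -> polynomial_map psi -> cancel phi psi ->
  zariski_closed X -> (forall w, X (phi w)) ->
  chain_to X (\dim {:W}) (zariski_closure (range phi)).
Proof.
move=> phiP psiP phiK cX phiX.
have rangeE : range phi = range (fun x : W * 'rV[K]_0 => phi x.1).
  by apply/seteqP; split=> _ [w _ <-]; [exists (w, 0)|exists w.1].
rewrite rangeE -[\dim _]add0n; apply: chain_to_flag => //.
- by apply: (polymap_comp phiP); polymap.
- by exact: psiP.
apply: chain_to0; first exact: zariski_closure_closed.
  by apply: irreducible_closure_image => //; [exact: (polymap_cst _ (phi 0))|exists 0].
by apply: zariski_closure_min => // _ [u _ <-].
Qed.

End Dimension.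

(** * Ranks and minors *)

Section RankAndMinors.
Variable K : fieldType.

Lemma mxrank_factor l n r (v : 'M[K]_(l, n)) :
  (\rank v <= r)%N ->
  exists P : 'M[K]_(l, r), exists Q : 'M[K]_(r, n), v = P *m Q.
Proof.
move=> vr; exists (col_ebase v *m pid_mx (\rank v)).
exists (pid_mx (\rank v) *m row_ebase v).
rewrite mulmxA -[col_ebase v *m _ *m _]mulmxA.
by rewrite mul_pid_mx minnn (minn_idPr vr) mulmx_ebase.
Qed.

Lemma det0_rank l (A : 'M[K]_l) : (\det A == 0) = (\rank A < l)%N.
Proof.
rewrite ltn_neqAle rank_leq_row andbT -[\rank A == l]/(row_free A).
by rewrite row_free_unit unitmxE unitfE negbK.
Qed.

Lemma mxrank_colsub l n k (f : 'I_k -> 'I_n) (v : 'M[K]_(l, n)) :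
  (\rank (colsub f v) <= \rank v)%N.
Proof. by rewrite -[v in colsub f v]mulmx1 -mulmx_colsub mxrankM_maxl. Qed.

Lemma full_rank_minor l n (v : 'M[K]_(l, n)) :
  (l <= \rank v)%N -> exists f : 'I_l -> 'I_n, \det (colsub f v) != 0.
Proof.
move=> lv; have vfull : row_full v^T by rewrite /row_full mxrank_tr eqn_leq rank_leq_row.
exists (fullrankfun vfull); have := fullrowsub_unit vfull.
by rewrite -unitfE -unitmxE -(unitmx_tr (colsub _ _)) trmx_mxsub.
Qed.

(** Cramer's rule: by expansion along column [i]. *)
Lemma adj_colsub_mul l n (f : 'I_l -> 'I_n) (v : 'M[K]_(l, n)) i j :
  (\adj (colsub f v) *m v) i j =
  \det (colsub (fun k => if k == i then j else f k) v).
Proof.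
rewrite (expand_det_col _ i) mxE; apply: eq_bigr => k _.
rewrite !mxE eqxx mulrC; congr (_ * (_ * \det _)).
by apply/matrixP => a b; rewrite !mxE eq_sym (negPf (neq_lift _ _)).
Qed.

(** For a nonzero minor of [v], on the columns [f], take [g] to be the quotient of
    the square submatrices of [w] and [v] on these columns: by Cramer's rule all
    columns of [v] and [w] have the same coordinates with respect to them. *)
Lemma same_minors_SL l n (v w : 'M[K]_(l, n)) :
  (l <= \rank v)%N ->
  (forall f : 'I_l -> 'I_n, \det (colsub f v) = \det (colsub f w)) ->
  exists2 g, \det g = 1 & w = g *m v.
Proof.
move=> lv vw; have [f fv] := full_rank_minor lv.
have fvU : colsub f v \in unitmx by rewrite unitmxE unitfE.
have fwU : colsub f w \in unitmx by rewrite unitmxE unitfE -vw.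
exists (colsub f w *m invmx (colsub f v)).
  by rewrite det_mulmx det_inv -vw mulfV.
have adjE : \adj (colsub f w) *m w = \adj (colsub f v) *m v.
  by apply/matrixP => i j; rewrite !adj_colsub_mul vw.
rewrite /invmx fvU -mulmxA -scalemxAl -adjE vw scalemxAl mulmxA.
suff -> : (\det (colsub f w))^-1 *: \adj (colsub f w) = invmx (colsub f w).
  by rewrite mulmxV// mul1mx.
by rewrite /invmx fwU.
Qed.

Lemma dependent_row m n (v : 'M[K]_(m.+1, n)) :
  (\rank v < m.+1)%N ->
  exists i, exists c : 'rV[K]_m, row i v = c *m row' i v.
Proof.
move=> vm; have : kermx v != 0 by rewrite kermx_eq0 -row_leq_rank -ltnNge.
move=> /rowV0Pn [x /sub_kermxP xv /rV0Pn [i xi]].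
exists i, (\row_a - ((x 0 i)^-1 * x 0 (lift i a))); apply/rowP => j.
have /eqP := congr1 (fun y : 'rV_n => y 0 j) xv; rewrite !mxE (bigD1_ord i)//=.
rewrite addr_eq0 => /eqP /(congr1 ( *%R (x 0 i)^-1)).
rewrite mulrA mulVf// mul1r => ->; rewrite mulrN mulr_sumr -sumrN.
by apply: eq_bigr => a _; rewrite !mxE mulNr mulrA.
Qed.

End RankAndMinors.

(** * The two pieces of the separating variety *)

Section SeparatingVariety.
Variables (K : numFieldType) (m n : nat).
Local Notation V := 'M[K]_(m.+1, n).
Implicit Types (u v w : V) (f : V -> K).

Definition orbit_graph : set (V * V) :=
  [set x | exists2 g, \det g = 1 & x.2 = g *m x.1].

Definition rank_deficient_pairs : set (V * V) :=
  [set x | (\rank x.1 < m.+1)%N /\ (\rank x.2 < m.+1)%N].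

Local Notation S := (separating_variety K m.+1 n).

Lemma SL_invariant_mul f g v :
  @SL_invariants K m.+1 n f -> \det g = 1 -> f (g *m v) = f v.
Proof.
move=> [_ finv] g1; have gU : g \in unitmx by rewrite unitmxE g1 unitr1.
have /finv/(congr1 (@^~ v)) : @SL K m.+1 (invmx g).
  by rewrite /SL /= det_inv g1 invr1.
by rewrite /fun_act invmxK.
Qed.

Lemma minor_invariant (s : 'I_m.+1 -> 'I_n) :
  @SL_invariants K m.+1 n (fun v => \det (colsub s v)).
Proof.
split.
  apply: polyfun_det; apply: polymap_mx => i j.
  by under eq_fun do rewrite mxE; apply: polyfun_entry; exact: polymap_id.
move=> g g1; apply: funext => v; rewrite /fun_act -mulmx_colsub det_mulmx.
by rewrite det_inv g1 invr1 mul1r.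
Qed.

(** The one-parameter subgroup with weights 1, ..., 1, -m on a basis adapted to
    the column space of [v] multiplies [v] by [t]; so [f] is constant on the
    line through [v], including at 0. *)
Lemma invariant_rank_deficient f v :
  @SL_invariants K m.+1 n f -> (\rank v < m.+1)%N -> f v = f 0.
Proof.
move=> finv vm; have [fP _] := finv.
have ftv t : t != 0 -> f (t *: v) = f v.
  move=> t0; pose d : 'rV[K]_m.+1 := \row_i if i == ord_max then t ^- m else t.
  pose L := col_ebase v.
  have LU : L \in unitmx by exact: col_ebase_unit.
  pose g := L *m diag_mx d *m invmx L.
  have g1 : \det g = 1.
    rewrite !det_mulmx det_inv mulrAC mulfV ?mul1r -?unitfE -?unitmxE//.
    rewrite det_diag big_ord_recr /= mxE eqxx.
    under eq_bigr => i _.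
      rewrite mxE -val_eqE /= ltn_eqF//; over.
    by rewrite prodr_const card_ord mulfV// expf_neq0.
  rewrite -(SL_invariant_mul v finv g1); congr f.
  rewrite -[v in RHS]mulmx_ebase -[v in LHS]mulmx_ebase /g -/L.
  rewrite -!mulmxA mulKmx// !mulmxA scalemxAl; congr (_ *m _).
  rewrite -mulmxA scalemxAr; congr (_ *m _).
  apply/matrixP => i j; rewrite mul_diag_mx !mxE.
  have [->|//] := eqVneq i ord_max.
  by rewrite /= ltnNge -ltnS vm andbF !mulr0.
have [p pE] : exists p : {poly K}, forall t, f (t *: v) = p.[t].
  apply: (polyfun_curve (f := fun t : K^o => f (t *: v))).
  have tvP : polynomial_map (fun t : K^o => t *: v).
    by apply: polymapZ (polymap_cst _ _); exact: (@polyfun_linear _ K^o idfun).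
  exact: tvP fP.
have p0 : p - (f v)%:P = 0.
  apply: (@poly_cofinite0 K _ 'X); first by rewrite polyX_eq0.
  by move=> t; rewrite hornerX !hornerE -pE => /ftv ->; rewrite subrr.
have := pE 0; rewrite scale0r => ->.
by have /eqP := congr1 (fun q => q.[0]) p0; rewrite !hornerE subr_eq0 => /eqP.
Qed.

Lemma separating_variety_closed : zariski_closed S.
Proof.
have -> : S = [set x | forall f : {f | @SL_invariants K m.+1 n f},
    sval f x.1 - sval f x.2 = 0].
  apply/seteqP; split=> x /= Sx.
    by move=> [f finv] /=; rewrite Sx// subrr.
  by move=> f finv; apply/eqP; rewrite -subr_eq0 (Sx (exist _ f finv)).
apply: zariski_closed_forall => -[f [fP _]] /=; apply: zariski_closed_zeros.
by apply: polyfunB; [apply: (@polymap_fst K V V) f fP|apply: (@polymap_snd K V V) f fP].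
Qed.

Lemma orbit_graph_sub : orbit_graph `<=` S.
Proof. by move=> [v w] [g g1 /= ->] f /SL_invariant_mul ->. Qed.

Lemma rank_deficient_pairs_sub : rank_deficient_pairs `<=` S.
Proof.
by move=> [v w] [/= vm wm] f finv; rewrite !invariant_rank_deficient.
Qed.

Lemma separating_variety_cover : S `<=` orbit_graph `|` rank_deficient_pairs.
Proof.
move=> [v w] Svw.
have vw s : \det (colsub s v) = \det (colsub s w) := Svw _ (minor_invariant s).
have [vm|mv] := ltnP (\rank v) m.+1; last first.
  by left; have [g g1 wE] := same_minors_SL mv vw; exists g.
right; split=> //=; rewrite ltnNge; apply/negP => /full_rank_minor [s].
by rewrite -vw det0_rank (leq_ltn_trans (mxrank_colsub _ _)).
Qed.

Lemma rank_deficient_pairs_closed : zariski_closed rank_deficient_pairs.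
Proof.
have -> : rank_deficient_pairs = [set x | forall s : 'I_m.+1 -> 'I_n,
    \det (colsub s x.1) = 0] `&` [set x | forall s : 'I_m.+1 -> 'I_n,
    \det (colsub s x.2) = 0].
  have minors v : (\rank v < m.+1)%N <->
      forall s : 'I_m.+1 -> 'I_n, \det (colsub s v) = 0.
    split=> [vm s|vs].
      by apply/eqP; rewrite det0_rank (leq_ltn_trans (mxrank_colsub _ _)).
    by rewrite ltnNge; apply/negP => /full_rank_minor [s]; rewrite vs eqxx.
  by apply/seteqP; split=> x [/minors ? /minors ?]; split.
apply: zariski_closedI; apply: zariski_closed_forall => s;
  apply: zariski_closed_zeros; have [detP _] := minor_invariant s.
- exact: (@polymap_fst K V V _ detP).
- exact: (@polymap_snd K V V _ detP).
Qed.

End SeparatingVariety.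

Arguments orbit_graph : clear implicits.
Arguments rank_deficient_pairs : clear implicits.

(** * Irreducibility and inclusions of the pieces *)

Section OrbitGraph.
Variables (K : numFieldType) (m n : nat).
Local Notation V := 'M[K]_(m.+1, n).

(** In the normal form of Gaussian elimination, the diagonal zeros are replaced by
    [t] and the last of them by a multiple of a power of [t] that brings the
    determinant to a value independent of [A]. *)
Lemma singular_curve (A : 'M[K]_m.+1) :
  \det A = 0 ->
  exists2 gamma : K^o -> 'M[K]_m.+1, polynomial_map gamma &
    gamma 0 = A /\ forall t, \det (gamma t) = t ^+ m.+1.
Proof.
move=> /eqP; rewrite det0_rank => rm; pose r := \rank A.
pose c := \det (col_ebase A) * \det (row_ebase A).
have c0 : c != 0.
  by rewrite mulf_neq0// -unitfE -unitmxE ?col_ebase_unit ?row_ebase_unit.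
pose e := (\sum_(i < m) (r <= i))%N.
have em : (e <= m)%N.
  by rewrite -[leqRHS]card_ord -sum1_card; apply: leq_sum => i _; exact: leq_b1.
pose d (t : K) (i : 'I_m.+1) :=
  if i == ord_max then c^-1 * t ^+ (m.+1 - e) else t ^+ (r <= i)%N.
exists (fun t => col_ebase A *m diag_mx (\row_i d t i) *m row_ebase A).
  polymap; apply: polymap_mx => i j.
  have tkP k : polynomial_fun (fun t : K^o => t ^+ k).
    by have := curve_polyfun ('X^k : {poly K}); under eq_fun do rewrite hornerXn.
  under eq_fun do rewrite mxE /d; case: eqP => _; last exact: tkP.
  exact: polyfunM (polyfun_cst _ _) (tkP _).
split=> [|t].
  rewrite -[RHS]mulmx_ebase; congr (_ *m _ *m _); apply/matrixP => i j.
  rewrite !mxE /d -/r val_eqE; have [ij|] := eqVneq i j; last by rewrite mulr0n.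
  rewrite mulr1n; have [->|_] := eqVneq i ord_max.
    by rewrite expr0n subn_eq0 ltnNge em mulr0 /= ltnNge -ltnS rm.
  by rewrite expr0n leqNgt; case: (i < r)%N.
rewrite !det_mulmx mulrAC -/c det_diag big_ord_recr /= mxE /d eqxx.
under eq_bigr => i _.
  rewrite mxE -val_eqE /= ltn_eqF//; over.
by rewrite prodrXr -/e mulrCA mulVKf// -exprD subnKC// leqW.
Qed.

(** When both determinants vanish, the pair is the value at [t = 0] of a curve that
    lies in the graph for all other [t]. *)
Lemma closure_orbit_graph_mul (A B : 'M[K]_m.+1) (u : V) :
  \det A = \det B -> zariski_closure (orbit_graph K m n) (A *m u, B *m u).
Proof.
move=> AB; have [A0|A0] := eqVneq (\det A) 0; last first.
  have AU : A \in unitmx by rewrite unitmxE unitfE.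
  apply: sub_zariski_closure; exists (B *m invmx A).
    by rewrite det_mulmx det_inv -AB mulfV.
  by rewrite /= -mulmxA mulKmx.
have [gA gAP [gA0 gAt]] := singular_curve A0.
have [gB gBP [gB0 gBt]] := singular_curve (etrans (esym AB) A0).
move=> f fP fgraph.
have gP : polynomial_map (fun t : K^o => (gA t *m u, gB t *m u)).
  by polymap.
have [p pE] := polyfun_curve (gP f fP).
have p0 : p = 0.
  apply: (@poly_cofinite0 K _ 'X); first by rewrite polyX_eq0.
  move=> t; rewrite hornerX -pE => t0; apply: fgraph => /=.
  have AU : gA t \in unitmx by rewrite unitmxE unitfE gAt expf_neq0.
  exists (gB t *m invmx (gA t)); last by rewrite /= -mulmxA mulKmx.
  by rewrite det_mulmx det_inv gAt gBt mulfV// expf_neq0.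
by have := pE 0; rewrite /= gA0 gB0 p0 horner0.
Qed.

(** The segment from [g] to [g'] leaves the special linear group, but its
    determinant can be matched in the first component. *)
Lemma irreducible_closure_orbit_graph :
  zariski_irreducible (zariski_closure (orbit_graph K m n)).
Proof.
apply: irreducible_closure.
  by exists (0, 0); exists 1%:M; rewrite ?det1//= mul1mx.
move=> [v _] [v' _] [g g1 /= ->] [g' g'1 /= ->].
pose B (t : K^o) := g + t *: (g' - g).
pose A (t : K^o) : 'M[K]_m.+1 :=
  diag_mx (\row_i (if i == ord0 then \det (B t) else 1)).
pose u (t : K^o) := v + t *: (v' - v).
have detA t : \det (A t) = \det (B t).
  by rewrite det_diag big_ord_recl mxE eqxx big1 ?mulr1// => i _; rewrite mxE.
have A1 t : \det (B t) = 1 -> A t = 1%:M.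
  move=> Bt; apply/matrixP => i j; rewrite !mxE Bt.
  by case: (i == ord0).
have [B0 B1] : B 0 = g /\ B 1 = g'.
  by rewrite /B scale0r addr0 scale1r subrKC.
exists (fun t => (A t *m u t, B t *m u t)).
  apply: polymap_pair; apply: polymap_mulmx;
    [|exact: polymap_segment|exact: polymap_segment|exact: polymap_segment].
  apply: polymap_mx => i j; under eq_fun do rewrite !mxE -mulr_natr.
  apply: polyfunM (polyfun_cst _ _); case: eqP => _; last exact: polyfun_cst.
  by apply: polyfun_det; exact: polymap_segment.
split=> [||t]; last by apply: closure_orbit_graph_mul; rewrite detA.
- by rewrite A1 ?B0// mul1mx /u scale0r addr0.
- by rewrite A1 ?B1// mul1mx /u scale1r subrKC.
Qed.

(** Factorizations through a space of dimension [m] form a vector space. *)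
Lemma irreducible_rank_deficient_pairs :
  zariski_irreducible (rank_deficient_pairs K m n).
Proof.
pose W := ('M[K]_(m.+1, m) * 'M[K]_(m, n))%type.
pose phi (x : W * W) : V * V := (x.1.1 *m x.1.2, x.2.1 *m x.2.2).
have -> : rank_deficient_pairs K m n = zariski_closure (phi @` setT).
  have <- : rank_deficient_pairs K m n = phi @` setT.
    apply/seteqP; split=> [[v w] []|_ [x _ <-]] /=.
      move=> /mxrank_factor [P [Q ->]] /mxrank_factor [P' [Q' ->]].
      by exists ((P, Q), (P', Q')).
    by split; rewrite ltnS (leq_trans (mxrankM_maxr _ _)) ?rank_leq_row.
  by rewrite zariski_closure_id//; exact: rank_deficient_pairs_closed.
apply: irreducible_closure_image => //; last by exists 0.
by rewrite /phi; polymap.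
Qed.

Local Notation C1 := (zariski_closure (orbit_graph K m n)).
Local Notation C2 := (rank_deficient_pairs K m n).

(** On the graph of the action the rows of [v] and [w] together span a space of
    dimension at most [m.+1]; for a rank deficient pair they can span
    more, because [2 * m > m.+1] and [n > m.+1]. *)
Lemma rank_deficient_pairs_not_sub : (1 < m)%N -> (m.+1 < n)%N -> ~ C2 `<=` C1.
Proof.
move=> m1 mn.
(* The identity of size [m.+2] splits into parts of rank [m] and [2], which are
   carried by the first and by the second matrix of the pair. *)
have [|X1 [Y1 XY1]] := @mxrank_factor K m.+2 m.+2 m (pid_mx m).
  by rewrite rank_pid_mx// leqW.
have [|X2 [Y2 XY2]] := @mxrank_factor K m.+2 m.+2 m (copid_mx m).
  by rewrite rank_copid_mx ?leqW// -addn2 addKn.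
pose E : 'M[K]_(n, m.+2) := pid_mx m.+2.
have ETE : E^T *m E = 1%:M.
  by rewrite tr_pid_mx mul_pid_mx minnn (minn_idPr mn) pid_mx_1.
pose L p (X : 'M[K]_(m.+2, m)) (v : 'M[K]_(1 + m, p)) := row_mx (0 : 'cV_m.+2) X *m v.
pose pad (Y : 'M[K]_(m, m.+2)) : V := col_mx (0 : 'rV_n) (Y *m E^T).
have padE X Y : L _ X (pad Y) *m E = X *m Y.
  by rewrite /L mul_row_col mul0mx add0r !mulmxA -mulmxA ETE mulmx1.
have pad_rank Y : (\rank (pad Y) < m.+1)%N.
  have -> : pad Y = col_mx (0 : 'M_(1, m)) 1%:M *m (Y *m E^T).
    by rewrite mul_col_mx mul0mx mul1mx.
  by rewrite ltnS (leq_trans (mxrankM_maxr _ _)) ?rank_leq_row.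
move=> C21; have {C21} : C1 (pad Y1, pad Y2).
  exact: (C21 (pad Y1, pad Y2) (conj (pad_rank Y1) (pad_rank Y2))).
pose F (x : V * V) := \det (L _ X1 x.1 *m E + L _ X2 x.2 *m E).
have F1 : F (pad Y1, pad Y2) = 1.
  by rewrite /F /= !padE -XY1 -XY2 /copid_mx addrC subrK det1.
move=> /(_ F) FC1; have /eqP := oner_neq0 K; apply; rewrite -F1; apply: FC1.
  by apply: polyfun_det; rewrite /L; polymap.
move=> [v w] [g _ /= ->]; apply/eqP; rewrite /F /L /= !mulmxA -!mulmxDl det0_rank.
rewrite ltnS (leq_trans (mxrankM_maxl _ _))//.
by rewrite (leq_trans (mxrankM_maxr _ _)) ?rank_leq_row.
Qed.

End OrbitGraph.

(** Both matrices are a column times a row; the two rows form [u], and the columns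
    padded by zero are singular. *)
Lemma rank_deficient_pairs_sub2 (K : numFieldType) n :
  rank_deficient_pairs K 1 n `<=` zariski_closure (orbit_graph K 1 n).
Proof.
move=> [v w] [/= /mxrank_factor [P [Q ->]] /mxrank_factor [P' [Q' ->]]].
pose A : 'M[K]_(1 + 1) := row_mx P 0; pose B : 'M[K]_(1 + 1) := row_mx 0 P'.
have -> : P *m Q = A *m col_mx Q Q' by rewrite mul_row_col mul0mx addr0.
have -> : P' *m Q' = B *m col_mx Q Q' by rewrite mul_row_col mul0mx add0r.
apply: closure_orbit_graph_mul.
have A0 : \det A == 0 by rewrite det0_rank rank_row_mx0 ltnS rank_leq_col.
have B0 : \det B == 0 by rewrite det0_rank rank_row_0mx ltnS rank_leq_col.
by rewrite (eqP A0) (eqP B0).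
Qed.

(** * Upper bounds on dimensions *)

Section UpperBounds.
Variables (K : numFieldType) (m n : nat).
Local Notation V := 'M[K]_(m.+1, n).
Local Notation C1 := (zariski_closure (orbit_graph K m n)).
Local Notation C2 := (rank_deficient_pairs K m n).

Definition insert_row (i : 'I_m.+1) (x : 'rV[K]_m * 'M[K]_(m, n)) : V :=
  \matrix_(a, b) if unlift i a is Some a' then x.2 a' b else (x.1 *m x.2) 0 b.

(** Some row of a rank deficient matrix is a combination of the others, so that
    the maps [insert_row i] form a system of charts. *)
Lemma alg_indep_rank_deficient_pairs k (f : 'I_k -> V * V -> K) :
  (forall i, polynomial_fun (f i)) -> alg_indep (rank_deficient_pairs K m n) f ->
  (k <= (m + m * n) + (m + m * n))%N.
Proof.
pose W := ('rV[K]_m * 'M[K]_(m, n))%type.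
pose phi (i : 'I_m.+1 * 'I_m.+1) (x : W * W) :=
  (insert_row i.1 x.1, insert_row i.2 x.2).
have insP i : polynomial_map (insert_row i).
  apply: polymap_mx => a b; under eq_fun do rewrite mxE.
  by case: unlift => [a'|]; apply: polyfun_entry; polymap.
have insE v i c : row i v = c *m row' i v -> v = insert_row i (c, row' i v).
  move=> vi; apply/matrixP => a b; rewrite mxE /=.
  by case: unliftP => [a' ->|->]; rewrite -?vi !mxE.
have := @alg_indep_charts K _ (W * W)%type _ (rank_deficient_pairs K m n) phi k f.
rewrite !dim_prod !dim_mx mul1n; apply.
  move=> i; apply: polymap_pair; apply: polymap_comp (insP _) _; polymap.
move=> [v w] [/= /dependent_row [i [c /insE vE]] /dependent_row [j [c' /insE wE]]].
by exists (i, j), ((c, row' i v), (c', row' j w)); rewrite /phi /= -vE -wE.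
Qed.

(** The equation [\det g = 1] lowers the dimension of the parameter space by
    one. *)
Lemma alg_indep_orbit_graph k (f : 'I_k -> V * V -> K) :
  (forall i, polynomial_fun (f i)) ->
  alg_indep (zariski_closure (orbit_graph K m n)) f ->
  (k < m.+1 * n + m.+1 * m.+1)%N.
Proof.
move=> fP /(alg_indep_closure fP) findep.
pose W := (V * 'M[K]_m.+1)%type.
pose phi (x : W) := (x.1, x.2 *m x.1).
pose T := [set x : W | \det x.2 = 1].
have graphE : orbit_graph K m n = phi @` T.
  apply/seteqP; split=> [[v w] [g g1 /= ->]|_ [[v g] g1 <-]]; last by exists g.
  by exists (v, g).
rewrite graphE in findep; have {}findep := alg_indep_image findep.
have phiP : polynomial_map phi by rewrite /phi; polymap.
have fphiP i : polynomial_fun (f i \o phi) by exact: phiP.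
pose h (x : W) := \det x.2 - 1.
have hP : polynomial_fun h.
  by apply: polyfunB (polyfun_cst _ _); apply: polyfun_det; polymap.
have := @alg_indep_leq_dim K W k.+1 (fun_rcons (fun i => f i \o phi) h).
rewrite dim_prod !dim_mx; apply; first exact: polyfun_rcons.
apply: alg_indep_rcons findep _ (@integral_setT K W) _ => //.
  by move=> x; rewrite /T /h /= => ->; rewrite subrr.
move=> /(_ 0 I) /eqP; rewrite /h /= det0 sub0r oppr_eq0.
by rewrite (negPf (oner_neq0 _)).
Qed.

Lemma nonvanishing_minor : (m < n)%N ->
  exists2 s : 'I_m.+1 -> 'I_n,
    exists2 x, C1 x & \det (colsub s x.1) != 0 &
    forall x : V * V, C2 x -> \det (colsub s x.1) = 0.
Proof.
move=> mn; pose u : V := pid_mx m.+1.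
have [|s su] := @full_rank_minor K _ _ u; first by rewrite rank_pid_mx.
exists s; last first.
  move=> x [xm _]; apply/eqP; rewrite det0_rank.
  exact: leq_ltn_trans (mxrank_colsub _ _) xm.
exists (u, u) => //; apply: sub_zariski_closure.
by exists 1%:M; rewrite ?det1//= mul1mx.
Qed.

(** On the irreducible set [C1] the minor is one more independent function. *)
Lemma alg_indep_intersection k (f : 'I_k -> V * V -> K) :
  (m < n)%N ->
  (forall i, polynomial_fun (f i)) -> alg_indep (C1 `&` C2) f ->
  (k.+1 < m.+1 * n + m.+1 * m.+1)%N.
Proof.
move=> mn fP findep; have [s [x C1x sx] sC2] := nonvanishing_minor mn.
have hP : polynomial_fun (fun x : V * V => \det (colsub s x.1)).
  have [detP _] := @minor_invariant K m n s.
  exact: (@polymap_fst K V V _ detP).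
apply: alg_indep_orbit_graph (polyfun_rcons fP hP) _.
apply: alg_indep_rcons fP hP (@subIsetl _ _ _) findep _ _ _.
- by move=> y [_ /sC2].
- exact: irreducible_integral (@irreducible_closure_orbit_graph K m n).
by move=> /(_ x C1x) /eqP; rewrite (negPf sx).
Qed.

End UpperBounds.

(** * Lower bounds on dimensions *)

Section LowerBounds.
Variable K : numFieldType.

Definition dependent_rows m n (x : 'rV[K]_m * 'M[K]_(m, n)) : 'M[K]_(1 + m, n) :=
  col_mx (x.1 *m x.2) x.2.

Lemma rank_dependent_rows m n x : (\rank (@dependent_rows m n x) < m.+1)%N.
Proof.
have -> : dependent_rows x = col_mx x.1 1%:M *m x.2.
  by rewrite mul_col_mx mul1mx.
by rewrite ltnS (leq_trans (mxrankM_maxr _ _)) ?rank_leq_row.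
Qed.

(** The coefficients of the relation are read off while the other rows stay at
    the base point [r0], which has a right inverse; then the rows are freed. *)
Lemma chain_rank_deficient_pairs m n : (m <= n)%N ->
  exists Z, chain_to (rank_deficient_pairs K m n)
    ((m + m) + (m * n + m * n)) Z.
Proof.
move=> mn; set X := rank_deficient_pairs _ _ _.
pose r0 : 'M[K]_(m, n) := pid_mx m.
have r0K : r0 *m r0^T = 1%:M.
  by rewrite tr_pid_mx mul_pid_mx minnn (minn_idPr mn) pid_mx_1.
have cX : zariski_closed X by exact: rank_deficient_pairs_closed.
pose W1 := ('rV[K]_m * 'rV[K]_m)%type.
pose W2 := ('M[K]_(m, n) * 'M[K]_(m, n))%type.
pose phi2 (x : W2 * W1) := (dependent_rows (x.2.1, r0 + x.1.1),
                            dependent_rows (x.2.2, r0 + x.1.2)).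
pose phi1 (x : W1) := phi2 (0, x).
pose psi1 (x : 'M[K]_(1 + m, n) * 'M[K]_(1 + m, n)) : W1 :=
  (usubmx x.1 *m r0^T, usubmx x.2 *m r0^T).
pose psi2 (x : 'M[K]_(1 + m, n) * 'M[K]_(1 + m, n)) : W2 :=
  (- r0 + dsubmx x.1, - r0 + dsubmx x.2).
have phi2P : polynomial_map phi2.
  by rewrite /phi2 /dependent_rows; polymap.
have phi2X x : X (phi2 x) by split; exact: rank_dependent_rows.
exists (zariski_closure (range phi2)).
have -> : (m * n + m * n = \dim {:W2})%N by rewrite dim_prod !dim_mx.
have -> : (m + m = \dim {:W1})%N by rewrite dim_prod !dim_mx !mul1n.
apply: (@chain_to_flag K W1 _ W2 X _ phi2 psi2) => //.
- by rewrite /psi2; polymap.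
- by move=> [[r r'] c]; rewrite /psi2 /phi2 /dependent_rows /= !col_mxKd !addKr.
apply: (@chain_to_section K _ W1 X phi1 psi1) => //.
- by apply: (polymap_comp phi2P); polymap.
- by rewrite /psi1; polymap.
- move=> [c c']; rewrite /phi1 /psi1 /phi2 /dependent_rows /= !col_mxKu.
  by rewrite !addr0 -!mulmxA r0K !mulmx1.
- by move=> w; exact: phi2X.
Qed.

(** A generic point of the intersection is [(A u, B u)] with [A], [B] singular
    and [u = row_mx 1 u']. The base points [rA] and [rB] have no common kernel,
    so that [u'] can be read off [(A u', B u')]. *)
Lemma chain_intersection m p : (0 < m)%N ->
  exists2 Z, Z `<=` zariski_closure (orbit_graph K m (1 + m + p)) `&`
                   rank_deficient_pairs K m (1 + m + p) &
    chain_to (zariski_closure (orbit_graph K m (1 + m + p)) `&`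
              rank_deficient_pairs K m (1 + m + p))
      (((1 + m) * p + (m + m)) + (m * (1 + m) + m * (1 + m))) Z.
Proof.
move=> m0; set X := _ `&` _; pose l := (1 + m)%N.
have cX : zariski_closed X.
  apply: zariski_closedI; first exact: zariski_closure_closed.
  exact: rank_deficient_pairs_closed.
pose rA : 'M[K]_(m, l) := row_mx 0 1%:M.
pose rB : 'M[K]_(m, l) := pid_mx m.
have rAK : rA *m rA^T = 1%:M.
  by rewrite tr_row_mx mul_row_col mul0mx add0r trmx1 mulmx1.
have rBK : rB *m rB^T = 1%:M.
  by rewrite tr_pid_mx mul_pid_mx minnn (minn_idPr (leqnSn m)) pid_mx_1.
have rABK : rA^T *m rA + (pid_mx 1 : 'M_(l, m)) *m rB = 1%:M.
  rewrite mul_pid_mx (minn_idPl m0) (minn_idPr m0) pid_mx_block.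
  rewrite tr_row_mx trmx0 trmx1 mul_col_row !mul0mx mulmx0 mulmx1.
  by rewrite add_block_mx !addr0 !add0r -scalar_mx_block.
pose W1 := 'M[K]_(l, p).
pose W2 := ('rV[K]_m * 'rV[K]_m)%type.
pose W3 := ('M[K]_(m, l) * 'M[K]_(m, l))%type.
pose u (x : W1) : 'M[K]_(l, l + p) := row_mx 1%:M x.
pose phi3 (x : W3 * (W2 * W1)) :=
  (dependent_rows (x.2.1.1, rA + x.1.1) *m u x.2.2,
   dependent_rows (x.2.1.2, rB + x.1.2) *m u x.2.2).
(* The right columns of [u] are freed first, then the relations between the rows
   of [A] and of [B], and last the rows themselves. *)
pose phi2 (x : W2 * W1) := phi3 (0, x).
pose phi1 (x : W1) := phi2 (0, x).
pose V := 'M[K]_(1 + m, l + p).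
pose psi3 (x : V * V) : W3 :=
  (- rA + dsubmx (lsubmx x.1), - rB + dsubmx (lsubmx x.2)).
pose psi2 (x : V * V) : W2 :=
  (usubmx (lsubmx x.1) *m rA^T, usubmx (lsubmx x.2) *m rB^T).
pose psi1 (x : V * V) : W1 :=
  rA^T *m dsubmx (rsubmx x.1) + pid_mx 1 *m dsubmx (rsubmx x.2).
have uE (A : 'M[K]_l) x : A *m u x = row_mx A (A *m x).
  by rewrite mul_mx_row mulmx1.
have phi3P : polynomial_map phi3.
  by rewrite /phi3 /dependent_rows /u; polymap.
have phi3X x : X (phi3 x).
  have detd y : \det (@dependent_rows m l y) = 0.
    by apply/eqP; rewrite det0_rank; exact: rank_dependent_rows.
  split; first by apply: closure_orbit_graph_mul; rewrite !detd.
  by split; apply: leq_ltn_trans (mxrankM_maxl _ _) (rank_dependent_rows _).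
exists (zariski_closure (range phi3)).
  by apply: zariski_closure_min => // _ [x _ <-].
have -> : (m * (1 + m) + m * (1 + m) = \dim {:W3})%N by rewrite dim_prod !dim_mx.
have -> : (m + m = \dim {:W2})%N by rewrite dim_prod !dim_mx !mul1n.
have -> : ((1 + m) * p = \dim {:W1})%N by rewrite !dim_mx.
apply: (@chain_to_flag K (W2 * W1)%type _ W3 X _ phi3 psi3) => //.
- by rewrite /psi3; polymap.
- move=> [[r r'] [c x]]; rewrite /psi3 /phi3 !uE !row_mxKl /dependent_rows /=.
  by rewrite !col_mxKd !addKr.
apply: (@chain_to_flag K W1 _ W2 X _ phi2 psi2) => //.
- by apply: (polymap_comp phi3P); polymap.
- by rewrite /psi2; polymap.
- move=> [[c c'] x]; rewrite /psi2 /phi2 /phi3 !uE !row_mxKl /dependent_rows /=.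
  by rewrite !col_mxKu !addr0 -!mulmxA rAK rBK !mulmx1.
- by move=> x; exact: phi3X.
apply: (@chain_to_section K _ W1 X phi1 psi1) => //.
- by apply: (polymap_comp phi3P); polymap.
- by rewrite /psi1; polymap.
- move=> x; rewrite /psi1 /phi1 /phi2 /phi3 !uE !row_mxKr /dependent_rows /=.
  rewrite !mul_col_mx !col_mxKd !addr0 !mulmxA -mulmxDl rABK mul1mx //.
- by move=> x; exact: phi3X.
Qed.

End LowerBounds.

(** * Dimensions and components *)

Section SeparatingVarietyDimensions.
Variables (K : numFieldType) (m n : nat).
Local Notation C1 := (zariski_closure (orbit_graph K m n)).
Local Notation C2 := (rank_deficient_pairs K m n).

Lemma separating_varietyE : separating_variety K m.+1 n = C1 `|` C2.
Proof.
apply/seteqP; split=> v.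
  move=> /separating_variety_cover [|]; last by right.
  by left; exact: sub_zariski_closure.
case; last exact: rank_deficient_pairs_sub.
apply: zariski_closure_min; first exact: separating_variety_closed.
exact: orbit_graph_sub.
Qed.

Lemma closed_intersection : zariski_closed (C1 `&` C2).
Proof.
apply: zariski_closedI; first exact: zariski_closure_closed.
exact: rank_deficient_pairs_closed.
Qed.

Let chain_C12 : (0 < m)%N -> (m < n)%N -> exists2 Z, Z `<=` C1 `&` C2 &
  chain_to (C1 `&` C2) (m.+1 * n + m.+1 ^ 2 - 2) Z.
Proof.
move=> m0 mn.
have [p nE] : exists p, n = (1 + m + p)%N by exists (n - m.+1)%N; rewrite subnKC.
rewrite nE; have [Z ZC chZ] := @chain_intersection K m p m0; exists Z => //.
suff -> : (m.+1 * (1 + m + p) + m.+1 ^ 2 - 2 =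
  (1 + m) * p + (m + m) + (m * (1 + m) + m * (1 + m)))%N by [].
by rewrite -mulnn; nia.
Qed.

Lemma dim_closure_orbit_graph : (0 < m)%N -> (m < n)%N ->
  zariski_dim C1 (m.+1 * n + m.+1 ^ 2 - 1).
Proof.
move=> m0 mn; split; last first.
  apply: zariski_dim_leP => k f fP /(alg_indep_orbit_graph fP).
  by rewrite -mulnn; lia.
have [Z ZC /(chain_to_sub (zariski_closure_closed _) (@subIsetl _ _ _)
  closed_intersection) chZ] := chain_C12 m0 mn.
suff [Zs ? _] : chain_to C1 (m.+1 * n + m.+1 ^ 2 - 1) C1 by exists Zs.
have -> : (m.+1 * n + m.+1 ^ 2 - 1 = (m.+1 * n + m.+1 ^ 2 - 2).+1)%N.
  by rewrite -mulnn; nia.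
apply: chain_toS chZ (zariski_closure_closed _) _ _ _ => //.
  exact: irreducible_closure_orbit_graph.
split; first by move=> x /ZC [].
have [s [x C1x sx] sC2] := @nonvanishing_minor K m n mn.
by move=> /(_ x C1x) /ZC [_ /sC2 /eqP]; rewrite (negPf sx).
Qed.

Lemma dim_rank_deficient_pairs : (m < n)%N -> zariski_dim C2 (2 * (n + 1) * m).
Proof.
move=> mn; split; last first.
  apply: zariski_dim_leP => k f fP /(alg_indep_rank_deficient_pairs fP).
  by lia.
have [Z] := @chain_rank_deficient_pairs K m n (ltnW mn).
suff -> : (m + m + (m * n + m * n) = 2 * (n + 1) * m)%N by move=> [Zs ? _]; exists Zs.
by lia.
Qed.

Lemma dim_intersection : (0 < m)%N -> (m < n)%N ->
  zariski_dim (C1 `&` C2) (m.+1 * n + m.+1 ^ 2 - 2).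
Proof.
move=> m0 mn; split; last first.
  apply: zariski_dim_leP => k f fP /(alg_indep_intersection mn fP).
  by rewrite -mulnn; lia.
by have [Z _ [Zs ? _]] := chain_C12 m0 mn; exists Zs.
Qed.

End SeparatingVarietyDimensions.

Lemma irreducible_componentsU (K : numFieldType) (V : vectType K) (A B : set V) :
  zariski_closed A -> zariski_irreducible A ->
  zariski_closed B -> zariski_irreducible B ->
  ~ A `<=` B -> ~ B `<=` A ->
  irreducible_components (A `|` B) = [set A; B].
Proof.
move=> cA iA cB iB nAB nBA; apply/seteqP; split=> Z.
  move=> [iZ ZAB Zmax]; have [_ /(_ A B cA cB ZAB) [ZA|ZB]] := iZ.
    by left; apply/esym/Zmax => //; exact: subsetUl.
  by right; apply/esym/Zmax => //; exact: subsetUr.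
case=> ->; split=> [//||Z' iZ' Z'AB sub].
- exact: subsetUl.
- have [_ /(_ A B cA cB Z'AB) [Z'A|Z'B]] := iZ'; first exact/seteqP.
  by case: nAB; exact: subset_trans sub Z'B.
- exact: subsetUr.
- have [_ /(_ A B cA cB Z'AB) [Z'A|Z'B]] := iZ'; last exact/seteqP.
  by case: nBA; exact: subset_trans sub Z'A.
Qed.

Theorem theorem1p15 (R : realType) (l n : nat)
    (hl : (1 <= l)%N) (hn : (l <= n)%N) :
  let K : fieldType := R[i] in
  let S : set ('M[K]_(l, n) * 'M[K]_(l, n)) := separating_variety K l n in
  ((3 <= l)%N ->
    exists C1 C2 : set ('M[K]_(l, n) * 'M[K]_(l, n)),
      [/\ [/\ zariski_closed C1, zariski_irreducible C1,
              zariski_closed C2, zariski_irreducible C2 & S = C1 `|` C2],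
          (l < n)%N -> C1 <> C2 /\ irreducible_components S = [set C1; C2],
          zariski_dim C1 (l * n + l ^ 2 - 1)%N /\
            zariski_dim C2 (2 * (n + 1) * (l - 1))%N,
          zariski_closed (C1 `&` C2) /\
            zariski_dim_le (C1 `&` C2) (l * n + l ^ 2 - 2)%N &
          l = 3%N -> zariski_dim (C1 `&` C2) (l * n + l ^ 2 - 2)%N])
  /\ (l = 2%N -> exists! C, irreducible_components S C).
Proof.
case: l hl hn => // m _ mn K S.
have SE : S = zariski_closure (orbit_graph R[i] m n) `|` rank_deficient_pairs R[i] m n.
  exact: separating_varietyE.
have cC1 := zariski_closure_closed (orbit_graph R[i] m n).
have cC2 := @rank_deficient_pairs_closed R[i] m n.
have iC1 := @irreducible_closure_orbit_graph R[i] m n.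
have iC2 := @irreducible_rank_deficient_pairs R[i] m n.
split=> [m2|[m1]].
  have m0 : (0 < m)%N := ltnW (m2 : (1 < m)%N).
  exists (zariski_closure (orbit_graph R[i] m n)), (rank_deficient_pairs R[i] m n).
  have dim12 := @dim_intersection R[i] m n m0 mn.
  split=> //.
  - move=> ln; have n21 := @rank_deficient_pairs_not_sub R[i] m n m2 ln.
    have [s [x C1x sx] sC2] := @nonvanishing_minor R[i] m n mn.
    have n12 : ~ zariski_closure (orbit_graph R[i] m n) `<=` rank_deficient_pairs R[i] m n.
      by move=> /(_ x C1x) /sC2 /eqP; rewrite (negPf sx).
    split; first by move=> C12; apply: n12; rewrite C12.
    by rewrite SE; exact: irreducible_componentsU.
  - rewrite subSS subn0; split; first exact: dim_closure_orbit_graph.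
    exact: dim_rank_deficient_pairs.
  - by split; [exact: closed_intersection|case: dim12].
rewrite m1 in S SE cC1 iC1 *.
have S1 : S = zariski_closure (orbit_graph R[i] 1 n).
  by rewrite SE; apply/setUidPl; exact: rank_deficient_pairs_sub2.
have {}iC1 : zariski_irreducible S by rewrite S1.
exists S; split; first by split=> // Z' _ Z'S SZ'; apply/seteqP.
by move=> Z [_ ZS Zmax]; apply: Zmax.
Qed.
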